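(* Let $T \colon X \to X$ be a (two-sided) subshift of finite type, where $X$ is not a finite set. Fix a constant $\lambda_0>0$. Then there exists a continuous map $A \colon X \to \mathrm{SL}^{\pm}(2,\mathbb{R})$ such that the cocycle $(T,A)$ is monochromatic with Lyapunov exponent $\lambda_0$ (that is, $\lambda(T,A,\mu)=\lambda_0$ for every $T$-invariant ergodic Borel probability measure $\mu$ on $X$), but $(T,A)$ is not uniformly hyperbolic.
   Context: $\mathrm{SL}^{\pm}(2,\mathbb{R})$ is the group of real $2\times 2$ matrices with determinant $\pm 1$. If $T\colon X\to X$ is a homeomorphism of a compact metric space and $A\colon X\to \mathrm{SL}^{\pm}(2,\mathbb{R})$ is continuous, the pair $(T,A)$ is called a cocycle, and $A^{(n)}(x)$ ($x \in X$, $n\in\mathbb{Z}$) is the unique family of matrices with $A^{(1)}(x)=A(x)$ and $A^{(m+n)}(x)=A^{(m)}(T^n x)A^{(n)}(x)$ for all $m,n \in \mathbb{Z}$. If $\mu$ is a $T$-invariant ergodic Borel probability measure, the (top) Lyapunov exponent $\lambda(T,A,\mu)\ge 0$ is the number such that $\lim_{n\to+\infty}\frac1n\log\|A^{(n)}(x)\|=\lambda(T,A,\mu)$ for $\mu$-almost every $x$. The cocycle is monochromatic if all ergodic $T$-invariant Borel probability measures have the same Lyapunov exponent. The cocycle $(T,A)$ is uniformly hyperbolic if $\liminf_{n\to\pm\infty}\inf_{x\in X}\frac{1}{|n|}\log\|A^{(n)}(x)\|>0$. *)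

(* Defs.v *)
From HB Require Import structures.
From mathcomp Require Import all_boot all_order all_algebra.
From mathcomp Require Import zify.
From mathcomp Require Import all_classical all_reals all_analysis.

Set Implicit Arguments.
Unset Strict Implicit.
Unset Printing Implicit Defensive.

Import Order.TTheory GRing.Theory Num.Theory.
Import numFieldNormedType.Exports.

Local Open Scope classical_set_scope.
Local Open Scope ring_scope.

Record homeomorphism (X : topologicalType) := Homeomorphism {
  homeo_fun :> X -> X;
  homeo_inv : X -> X;
  homeo_funK : cancel homeo_fun homeo_inv;
  homeo_invK : cancel homeo_inv homeo_fun;
  homeo_fun_continuous : continuous homeo_fun;
  homeo_inv_continuous : continuous homeo_inv }.

Definition homeo_iter (X : topologicalType) (T : homeomorphism X) (n : int) :
    X -> X :=
  match n with
  | Posz k => iter k T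
  | Negz k => iter k.+1 (homeo_inv T)
  end.

Definition SLpm2 (R : realType) : set 'M[R]_2 :=
  [set M | \det M = 1 \/ \det M = -1].
Arguments SLpm2 R : clear implicits.

Section Cocycle.
Variables (R : realType) (X : topologicalType).
Variables (T : homeomorphism X) (A : X -> SLpm2 R).

Fixpoint cocycle_nat (n : nat) (x : X) : 'M[R]_2 :=
  if n is k.+1 then \val (A (iter k T x)) *m cocycle_nat k x else 1%:M.

Definition cocycle (n : int) (x : X) : 'M[R]_2 :=
  match n with
  | Posz k => cocycle_nat k x
  | Negz k => invmx (cocycle_nat k.+1 (homeo_iter T (Negz k) x))
  end.

Lemma homeo_iterS (n : int) (x : X) :
  homeo_iter T (n + 1) x = T (homeo_iter T n x).
Proof.
case: n => [k|[|k]]; first by rewrite -PoszD addn1.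
- by rewrite /= homeo_invK.
- have -> : Negz k.+1 + 1 = Negz k by rewrite !NegzE -addn1 PoszD opprD addrNK.
  by rewrite /= homeo_invK.
Qed.

Lemma homeo_iterD (m n : int) (x : X) :
  homeo_iter T (m + n) x = homeo_iter T m (homeo_iter T n x).
Proof.
elim/int_rect: m => [|k IH|k IH]; first by rewrite add0r.
- have -> : k.+1%:Z + n = k%:Z + n + 1 by lia.
  have -> : k.+1%:Z = k%:Z + 1 by lia.
  by rewrite !homeo_iterS IH.
- apply: (can_inj (homeo_funK T)); rewrite -!homeo_iterS.
  have -> : - k.+1%:Z + 1 = - k%:Z by lia.
  rewrite -IH; congr (homeo_iter T _ x); lia.
Qed.

Lemma SLpm2_unitmx (M : SLpm2 R) : \val M \in unitmx.
Proof.
have [] : SLpm2 R (\val M) by exact: set_valP.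
- by rewrite unitmxE => ->; exact: unitr1.
- by rewrite unitmxE => ->; rewrite unitrN; exact: unitr1.
Qed.

Lemma cocycle_nat_unitmx (n : nat) (x : X) : cocycle_nat n x \in unitmx.
Proof.
elim: n => [|n IH] /=; first exact: unitmx1.
by rewrite unitmx_mul SLpm2_unitmx.
Qed.

Lemma cocycle_natSr (n : nat) (x : X) :
  cocycle_nat n.+1 x = cocycle_nat n (T x) *m \val (A x).
Proof.
elim: n => [|n IH]; first by rewrite /= mulmx1 mul1mx.
by rewrite -[LHS]/(\val (A (iter n.+1 T x)) *m cocycle_nat n.+1 x) IH mulmxA iterSr.
Qed.

Lemma cocycleS (n : int) (x : X) :
  cocycle (n + 1) x = \val (A (homeo_iter T n x)) *m cocycle n x.
Proof.
case: n => [k|[|k]]; first by rewrite -PoszD addn1.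
- by rewrite /= mulmx1 mulmxV // SLpm2_unitmx.
- have -> : Negz k.+1 + 1 = Negz k by rewrite !NegzE -addn1 PoszD opprD addrNK.
  rewrite /cocycle; set y := homeo_iter T (Negz k.+1) x.
  have -> : homeo_iter T (Negz k) x = T y by rewrite /y /= homeo_invK.
  rewrite [cocycle_nat k.+2 y]cocycle_natSr.
  have uC := cocycle_nat_unitmx k.+1 (T y); have uA := SLpm2_unitmx (A y).
  apply: (can_inj (mulKmx uC)).
  rewrite mulmxV // mulmxA mulmxV // unitmx_mul uC uA //.
Qed.

Lemma cocycle1 (x : X) : cocycle 1 x = \val (A x).
Proof. by rewrite /= mulmx1. Qed.

Lemma cocycleD (m n : int) (x : X) :
  cocycle (m + n) x = cocycle m (homeo_iter T n x) *m cocycle n x.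
Proof.
elim/int_rect: m => [|k IH|k IH]; first by rewrite add0r mul1mx.
- have -> : k.+1%:Z + n = k%:Z + n + 1 by lia.
  have -> : k.+1%:Z = k%:Z + 1 by lia.
  by rewrite !cocycleS IH mulmxA homeo_iterD.
- apply: (can_inj (mulKmx (SLpm2_unitmx
    (A (homeo_iter T (- k.+1%:Z + n) x))))).
  rewrite -cocycleS homeo_iterD mulmxA -cocycleS.
  have -> : - k.+1%:Z + 1 = - k%:Z by lia.
  rewrite -IH; congr (cocycle _ x); lia.
Qed.

(* [`|M|] is the library norm on matrices (largest absolute value of an
   entry); all norms on 'M_2 are equivalent, so the growth rates below do not
   depend on this choice. *)
Definition uniformly_hyperbolic : Prop :=
  (0 < limn_einf (fun n : nat =>
     ereal_inf [set (n%:R^-1 * ln `|cocycle n%:Z x|)%:E | x in [set: X]]))%E /\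
  (0 < limn_einf (fun n : nat =>
     ereal_inf [set (n%:R^-1 * ln `|cocycle (- n%:Z) x|)%:E | x in [set: X]]))%E.

End Cocycle.

Notation borel X := (g_sigma_algebraType (@open X)).

Section Lyapunov.
Variables (R : realType) (X : ptopologicalType) (T : homeomorphism X).

Definition invariant_measure (mu : probability (borel X) R) : Prop :=
  forall B : set (borel X), measurable B -> mu (T @^-1` B) = mu B.

Definition ergodic_measure (mu : probability (borel X) R) : Prop :=
  invariant_measure mu /\
  forall B : set (borel X), measurable B -> T @^-1` B = B ->
    mu B = 0%E \/ mu B = 1%E.

Definition is_lyapunov_exponent (A : X -> SLpm2 R)
    (mu : probability (borel X) R) (l : R) : Prop :=
  {ae mu, forall x : X,
    (fun n : nat => n%:R^-1 * ln `|cocycle T A n%:Z x|) @ \oo --> l}.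

Definition monochromatic_with (A : X -> SLpm2 R) (l : R) : Prop :=
  forall mu : probability (borel X) R,
    ergodic_measure mu -> is_lyapunov_exponent A mu l.

End Lyapunov.

Lemma prod_topology_continuous (X : topologicalType) (I : eqType)
    (K : I -> topologicalType) (f : X -> prod_topology K) :
  (forall i, continuous (fun x => f x i)) -> continuous f.
Proof.
move=> cf x.
apply/(@cvg_sup (prod_topology K) I (fun i => Topological.class
    (initial_topology (fun f : (forall i, K i) => f i)))) => i U.
move=> [_ [[W oW <-]] /= Wx /filterS]; apply.
by apply: (cf i x W); exact: open_nbhs_nbhs.
Qed.

Section Subshift.
Variables (S : finType) (F : seq (seq S)).

Definition full_shift := prod_topology (fun _ : int => discrete_topology S).

HB.instance Definition _ := Topological.on full_shift.

Definition word_at (x : full_shift) (i : int) (n : nat) : seq S :=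
  [seq x (i + k%:Z) | k <- iota 0 n].

Definition sft : set full_shift :=
  [set x | forall w : seq S, w \in F ->
    forall i : int, word_at x i (size w) <> w].

(* The library's measurable types are pointed, so the type of points of the
   subshift carries a proof that it has one. *)
Definition sft_space (ne : sft !=set0) : Type := sft.

Variable ne : sft !=set0.

HB.instance Definition _ := Topological.on (sft_space ne).
HB.instance Definition _ := isPointed.Build (sft_space ne)
  (exist _ (projT1 (cid ne)) (mem_set (projT2 (cid ne)))).

Definition full_translate (a : int) (x : full_shift) : full_shift :=
  fun i => x (i + a).

Lemma sft_translate (a : int) (x : full_shift) :
  x \in sft -> full_translate a x \in sft.
Proof.
move=> /set_mem Xx; apply/mem_set => w Fw i xw; apply: (Xx w Fw (i + a)).
by rewrite -[RHS]xw; apply: eq_map => k; rewrite /full_translate addrAC.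
Qed.

Definition translate (a : int) (x : sft_space ne) : sft_space ne :=
  exist _ (full_translate a (\val x)) (sft_translate a (valP x)).

Lemma translateK (a b : int) : a + b = 0 -> cancel (translate a) (translate b).
Proof.
move=> ab x; apply: val_inj; apply: funext => i /=.
by rewrite /full_translate -addrA [b + a]addrC ab addr0.
Qed.

Lemma full_translate_continuous (a : int) : continuous (full_translate a).
Proof.
apply: (@prod_topology_continuous _ int (fun=> discrete_topology S)) => i.
exact: (@proj_continuous int (fun=> discrete_topology S) (i + a)).
Qed.

Lemma translate_continuous (a : int) : continuous (translate a).
Proof.
apply: (@continuous_comp_initial _ _ _ (set_val : sft -> full_shift)) => x.
apply: (@continuous_comp _ _ _ set_val (full_translate a)).
- exact: (@initial_continuous sft full_shift set_val).
- exact: full_translate_continuous.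
Qed.

Definition sft_shift : homeomorphism (sft_space ne) :=
  Homeomorphism (translateK (addrN 1)) (translateK (addNr 1))
    (@translate_continuous 1) (@translate_continuous (-1)).

Lemma sft_shiftE (x : sft_space ne) (i : int) : \val (sft_shift x) i = \val x (i + 1).
Proof. by []. Qed.

End Subshift.

(* Main.v *)
(** Idea. An infinite subshift of finite type contains a point [x] in which some
    word occurs only once. Hence [x] is isolated in its orbit, and it has clopen
    neighbourhoods [V r] shrinking to [x] such that the time windows [[-r, r]]
    around visits to [V r] are pairwise disjoint. Let [A] be
    diag(L, 1/L), with L = exp(lambda0), except during these windows. At a visit
    of depth [r] the two axes are exchanged up to a small entry of order
    1/(r+1)^2, which vanishes only at [x]. The loss is polynomial in [r], so it
    is compensated by factors (m+1)/m at distance [m] from the visit, and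
    exponentially small shears at both ends of the window realign the expanding
    and contracting directions with the axes; these corrections tend to zero, so
    [A] is continuous. Off the orbit of [x], [A] is conjugate to diag(L, 1/L) by
    matrices growing at most linearly along orbits, so the exponent is lambda0 at
    every such point, while the orbit of [x], being aperiodic and countable, is
    null for every invariant probability. Along the orbit of [x] the expansion
    before the visit is cancelled exactly after it, so there is no uniform
    hyperbolicity. *)

Require Import Defs.
From mathcomp Require Import all_boot all_order all_algebra.
From mathcomp Require Import finmap zify ring lra.
From mathcomp Require Import all_classical all_reals all_analysis.
Set Implicit Arguments.
Unset Strict Implicit.
Unset Printing Implicit Defensive.
Import Order.TTheory GRing.Theory Num.Theory.
Import numFieldNormedType.Exports.
Local Open Scope classical_set_scope.
Local Open Scope ring_scope.

(** * Growth rates and locally constant predicates *)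

Lemma natrD_neq0 (R : realType) (p n : nat) : p.+1%:R + n%:R != 0 :> R.
Proof. by rewrite -natrD pnatr_eq0. Qed.

Lemma nat1rD_neq0 (R : realType) (n : nat) : 1 + n%:R != 0 :> R.
Proof. exact: (natrD_neq0 R 0). Qed.

(** The factor K (n+1) changes the logarithm by at most ln K + ln (n+1), which vanishes in the limit
    after division by n. *)
Lemma ln_growth (R : realType) (l K : R) (u : nat -> R) : 1 <= K ->
  (forall n, u n <= K * n.+1%:R * expR l ^+ n) ->
  (forall n, expR l ^+ n <= K * n.+1%:R * u n) ->
  (fun n : nat => n%:R^-1 * ln (u n)) @ \oo --> l.
Proof.
move=> K1 uK Ku.
have K0 : 0 < K by exact: lt_le_trans K1.
have u0 n : 0 < u n.
  have := lt_le_trans (exprn_gt0 n (expR_gt0 l)) (Ku n).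
  by rewrite pmulr_rgt0 // mulr_gt0.
pose w n := ln K + ln n.+1%:R.
have lnK n : ln (K * n.+1%:R) = w n by rewrite lnM // posrE.
have lnl n : ln (expR l ^+ n) = n%:R * l.
  by rewrite lnXn ?expR_gt0 // expRK mulr_natl.
have dist n : `|n%:R * l - ln (u n)| <= w n.
  have E0 : 0 < expR l ^+ n by rewrite exprn_gt0 ?expR_gt0.
  have Kn0 : 0 < K * n.+1%:R by rewrite mulr_gt0.
  have le1 : ln (expR l ^+ n) <= w n + ln (u n).
    by rewrite -lnK -lnM ?posrE // ler_ln ?posrE // mulr_gt0.
  have le2 : ln (u n) <= w n + ln (expR l ^+ n).
    by rewrite -lnK -lnM ?posrE // ler_ln ?posrE // mulr_gt0.
  by rewrite -lnl ler_norml; lra.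
apply/cvgrPdist_le => e e0.
(* From n + 1 <= (1 + 1/b)(1 + b n) and 1 + b n <= exp (b n) one gets ln (n+1) <= ln (1 + 1/b) + b
   n. This spends half of [e]; the other half absorbs the constant [c] once n >= c / b. *)
pose b := e / 2; have b0 : 0 < b by rewrite divr_gt0.
pose c := ln K + ln (1 + b^-1).
have wb n : w n <= c + b * n%:R.
  rewrite /w /c -addrA lerD2l -[b * _]expRK -lnM ?posrE ?expR_gt0 ?addr_gt0 ?invr_gt0 //.
  rewrite ler_ln ?posrE ?mulr_gt0 ?expR_gt0 ?addr_gt0 ?invr_gt0 //.
  apply: (@le_trans _ _ ((1 + b^-1) * (1 + b * n%:R))).
    rewrite mulrDl mul1r mulrDr mulr1 mulKf ?gt_eqF // -natr1.
    have : 0 <= b * n%:R by rewrite mulr_ge0 // ltW.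
    have : 0 <= b^-1 by rewrite invr_ge0 ltW.
    lra.
  by rewrite ler_wpM2l ?expR_ge1Dx // addr_ge0 // invr_ge0 ltW.
near=> n.
have n0 : 0 < n%:R :> R by rewrite ltr0n; near: n; exact: nbhs_infty_gt.
have -> : l - n%:R^-1 * ln (u n) = n%:R^-1 * (n%:R * l - ln (u n)).
  by rewrite mulrBr mulKf // gt_eqF.
rewrite normrM gtr0_norm ?invr_gt0 // mulrC ler_pdivrMr //.
apply: (le_trans (dist n)); apply: (le_trans (wb n)).
have cn : c / b <= n%:R by near: n; exact: nbhs_infty_ger.
have : c <= n%:R * b by rewrite -ler_pdivrMr.
have -> : e = b + b by rewrite /b -splitr.
by rewrite mulrDl; lra.
Unshelve. all: by end_near. Qed.

Lemma clopen_near (X : topologicalType) (U : set X) (w : X) : clopen U ->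
  \forall z \near w, U z <-> U w.
Proof.
move=> [oU cU]; have [Uw|nUw] := pselect (U w).
  by apply: filterS (open_nbhs_nbhs (conj oU Uw)) => z Uz.
have oC : open (~` U) by exact: closed_openC.
by apply: filterS (open_nbhs_nbhs (conj oC nUw)) => z nUz; split.
Qed.

(** * Norms and inverses of real 2x2 matrices *)

Section Matrix22.
Variable R : realType.
Implicit Types (a b c d e : R) (M N : 'M[R]_2).

Definition mx22 a b c d : 'M[R]_2 :=
  \matrix_(i, j) if i == 0 then (if j == 0 then a else b)
                 else (if j == 0 then c else d).

Lemma mx22_mul a b c d a' b' c' d' :
  mx22 a b c d *m mx22 a' b' c' d' =
  mx22 (a * a' + b * c') (a * b' + b * d') (c * a' + d * c') (c * b' + d * d').
Proof.
apply/matrixP => i j; rewrite !mxE !big_ord_recl big_ord0 !mxE /= addr0.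
by case: (i == 0); case: (j == 0).
Qed.

Lemma mx22_1 : mx22 1 0 0 1 = 1%:M.
Proof.
by apply/matrixP => -[[|[|//]] ?] [[|[|//]] ?]; rewrite !mxE.
Qed.

Lemma det_mx22 a b c d : \det (mx22 a b c d) = a * d - b * c.
Proof.
rewrite (expand_det_row _ 0) !big_ord_recl big_ord0 /cofactor !det_mx11 !mxE /=.
by rewrite expr0 expr1 mul1r mulN1r mulrN addr0.
Qed.

Lemma mx_norm_leP M e : 0 <= e -> reflect (forall i j, `|M i j| <= e) (`|M| <= e).
Proof.
move=> e0; rewrite [leLHS]/Num.Def.normr /= mx_normrE.
apply: (iffP (bigmax_leP _ _ _ _)) => [[_ h] i j|h]; first exact: (h (i, j)).
by split => // -[i j] _; exact: h.
Qed.

Lemma mx_entry_le_norm M i j : `|M i j| <= `|M|.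
Proof. by apply/(mx_norm_leP M (normr_ge0 M)). Qed.

Lemma mx22_norm_le a b c d e :
  `|a| <= e -> `|b| <= e -> `|c| <= e -> `|d| <= e -> `|mx22 a b c d| <= e.
Proof.
move=> ae be ce de; apply/mx_norm_leP; first exact: le_trans ae.
by move=> i j; rewrite !mxE; case: ifP => _; case: ifP.
Qed.

(** Each entry of the product is a sum of two terms; the largest-entry norm is not submultiplicative
    without the factor 2. *)
Lemma mx22_normM M N : `|M *m N| <= 2 * `|M| * `|N|.
Proof.
apply/mx_norm_leP; first by rewrite !mulr_ge0.
move=> i j; rewrite mxE !big_ord_recl big_ord0 addr0.
apply: (le_trans (ler_normD _ _)).
rewrite -mulrA mulr_natl mulr2n !normrM.
by apply: lerD; apply: ler_pM; rewrite ?mx_entry_le_norm.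
Qed.

Lemma mx22B a b c d a' b' c' d' :
  mx22 a b c d - mx22 a' b' c' d' = mx22 (a - a') (b - b') (c - c') (d - d').
Proof.
by apply/matrixP => i j; rewrite !mxE; case: (i == 0); case: (j == 0).
Qed.

(** The inverse is the adjugate, whose entries are those of [M] up to sign and position. *)
Lemma mx22_unimodular_inv M : \det M = 1 ->
  exists N, [/\ N *m M = 1%:M, M *m N = 1%:M & `|N| <= `|M|].
Proof.
have ME : M = mx22 (M 0 0) (M 0 1) (M 1 0) (M 1 1).
  by apply/matrixP => -[[|[|//]] p] [[|[|//]] q]; rewrite !mxE /=;
    congr (M _ _); apply: val_inj.
rewrite {1}ME det_mx22 => d1.
exists (mx22 (M 1 1) (- M 0 1) (- M 1 0) (M 0 0)); split.
- by rewrite ME mx22_mul -mx22_1 -ME; congr mx22; lra.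
- by rewrite ME mx22_mul -mx22_1 -ME; congr mx22; lra.
- by apply: mx22_norm_le; rewrite ?normrN mx_entry_le_norm.
Qed.

End Matrix22.

(** * Integer iterates of a homeomorphism *)

Section HomeoIter.
Variables (X : topologicalType) (T : homeomorphism X).

Lemma homeo_iterNK (k : int) : cancel (homeo_iter T k) (homeo_iter T (- k)).
Proof. by move=> y; rewrite -homeo_iterD addNr. Qed.

Lemma homeo_iterKN (k : int) : cancel (homeo_iter T (- k)) (homeo_iter T k).
Proof. by move=> y; rewrite -homeo_iterD subrr. Qed.

Lemma homeo_iterSr (k : int) (y : X) :
  homeo_iter T (k + 1) y = homeo_iter T k (T y).
Proof. by rewrite homeo_iterD. Qed.

Lemma homeo_iter_continuous (k : int) : continuous (homeo_iter T k).
Proof.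
have iter_cont (f : X -> X) : continuous f -> forall n, continuous (iter n f).
  move=> cf; elim => [|n IH] y; first exact: cvg_id.
  exact: (@continuous_comp _ _ _ (iter n f) f _ (IH y) (cf _)).
case: k => n; apply: iter_cont; [exact: homeo_fun_continuous|].
exact: homeo_inv_continuous.
Qed.

Lemma near_homeo_iter (k : int) (y : X) (P : X -> Prop) :
  (\forall z \near homeo_iter T k y, P z) ->
  \forall z \near y, P (homeo_iter T k z).
Proof. exact: homeo_iter_continuous. Qed.

End HomeoIter.

(* A point isolated in its orbit, with neighbourhoods shrinking to it so slowly
   visited that the time windows [[-r, r]] around visits to [V r] are disjoint. *)
Record isolating (X : topologicalType) (T : homeomorphism X) (x : X)
    (V : nat -> set X) : Prop := Isolating {
  isolating_clopen : forall r, clopen (V r);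
  isolating_decr : forall r s, (r <= s)%N -> V s `<=` V r;
  isolating_mem : forall r, V r x;
  isolating_eq : forall y, (forall r, V r y) -> y = x;
  isolating_sep : forall r k y, k != 0 -> (`|k| <= r.*2)%N -> V r y ->
    ~ V 1%N (homeo_iter T k y) }.

(** * Visits to the shrinking neighbourhoods and their depth *)

Section Excursions.
Variables (X : topologicalType) (T : homeomorphism X).
Variables (x : X) (V : nat -> set X) (isoV : isolating T x V).

Local Notation it := (homeo_iter T).

Lemma isolating_orbit (k : int) : k != 0 -> it k x <> x.
Proof.
move=> k0 kx; apply: (isolating_sep isoV (r := `|k|) (y := x) k0).
- lia.
- exact: isolating_mem isoV _.
- by rewrite kx; exact: isolating_mem isoV _.
Qed.

(** With r' <= r, the two visits are at most 2r apart and the shallower one still lies in [V 1], so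
    [isolating_sep] at depth r forces them to coincide. *)
Lemma window_uniq y (k k' : int) (r r' : nat) :
  (0 < r)%N -> (0 < r')%N -> (`|k| <= r)%N -> (`|k'| <= r')%N ->
  V r (it (- k) y) -> V r' (it (- k') y) -> k = k'.
Proof.
wlog rr' : k k' r r' / (r' <= r)%N.
  move=> h r0 r'0 kr kr' Vk Vk'; have [?|?] := leqP r' r.
    exact: (h k k' r r').
  by apply/esym; apply: (h k' k r' r) => //; exact: ltnW.
move=> r0 r'0 kr kr' Vk Vk'; apply/eqP; rewrite -subr_eq0; apply: contrapT.
move=> /negP k0; apply: (isolating_sep isoV k0 _ Vk); first by lia.
have -> : it (k - k') (it (- k) y) = it (- k') y.
  by rewrite -homeo_iterD; congr (it _ y); lia.
exact: isolating_decr isoV _ _ _ _ Vk'.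
Qed.

(** A negative [k] refers to a visit still to come. The depth is at least 1 because uniqueness of
    visits needs positive depths, also at time 0. *)
Definition visit y (k : int) := V (maxn 1 `|k|) (it (- k) y).

Lemma visit_uniq y k k' : visit y k -> visit y k' -> k = k'.
Proof. by apply: window_uniq; rewrite ?leq_max ?leqnn ?orbT. Qed.

Definition visit_time y : option int :=
  if pselect (exists k, visit y k) is left e then Some (projT1 (cid e))
  else None.

Lemma visit_timeP y k : visit_time y = Some k <-> visit y k.
Proof.
rewrite /visit_time; case: pselect => [e|ne]; last first.
  by split=> // vk; case: ne; exists k.
case: cid => k' vk' /=; split=> [[<-]//|vk].
by congr Some; exact: visit_uniq vk' vk.
Qed.

Lemma visit_timeN y : visit_time y = None <-> forall k, ~ visit y k.
Proof.
split=> [nv k /visit_timeP|nv]; first by rewrite nv.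
by case E: (visit_time y) => [k|//]; move/visit_timeP: E => /nv.
Qed.

(** The index of the last [V r] containing [z]. No such index exists at [x], where 0 is only a
    default. *)
Definition rank z : nat := xget 0%N [set r | V r z /\ ~ V r.+1 z].

Lemma rank_eq r z : V r z -> ~ V r.+1 z -> rank z = r.
Proof.
move=> Vr nVr; apply: xget_unique => // s [Vs nVs]; apply/eqP.
rewrite eqn_leq; apply/andP; split; rewrite leqNgt; apply/negP => rs.
  by apply: nVr; exact: isolating_decr isoV _ _ rs _ Vs.
by apply: nVs; exact: isolating_decr isoV _ _ rs _ Vr.
Qed.

Lemma rankP s z : V s z -> z <> x ->
  [/\ (s <= rank z)%N, V (rank z) z & ~ V (rank z).+1 z].
Proof.
move=> Vs zx.
have ex : exists r, ~~ `[< V r z >].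
  apply: contrapT => h; apply: zx; apply: (isolating_eq isoV) => r.
  by apply: contrapT => nV; apply: h; exists r; apply/asboolPn.
case: (ex_minnP ex) => r /asboolPn nVr minr.
case: r nVr minr => [|r] nVr minr.
  by case: nVr; apply: isolating_decr isoV _ _ _ _ Vs.
have Vr : V r z.
  by apply: contrapT => /asboolPn /minr; rewrite ltnn.
rewrite (rank_eq Vr nVr); split => //; rewrite leqNgt; apply/negP => rs.
by apply: nVr; exact: isolating_decr isoV _ _ rs _ Vs.
Qed.

(** * Construction of the matrices and of the frames along a window *)

Variables (R : realType) (L : R) (L_gt1 : 1 < L).

(** The product of the first r ratios telescopes to r + 1. The two halves of a window of depth r
    thus gain (r+1)^2, which offsets the value (r+1)^-2 of [tilt]. *)
Definition ratio (m : nat) : R := m.+2%:R / m.+1%:R.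

(** During a visit at time m+1 or -(m+1), the test fails exactly when [z] has rank m+1; so the shear
    acts only in the first and in the last step of a window. *)
Definition hook (m : nat) z : R :=
  if `[< V m.+2 z >] then 0 else L ^- (m.+1).*2 * ratio m.

Definition tilt z : R := if `[< z = x >] then 0 else (rank z).+1%:R ^- 2.

(* [L] is the exponential of the exponent and [k] the time elapsed since the
   visit [z] to [V]. At [z = x], where all corner terms vanish, the matrix at
   time [0] exchanges the expanding and the contracting axis. *)
Definition step (k : int) z : 'M[R]_2 :=
  match k with
  | Posz 0 => mx22 (L * tilt z) (-1) 1 0
  | Posz m.+1 => mx22 (L * ratio m) 0 (- hook m z) (L * ratio m)^-1
  | Negz m => mx22 (L * ratio m) (hook m z) 0 (L * ratio m)^-1
  end.

Definition hyp_diag : 'M[R]_2 := mx22 L 0 0 L^-1.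

Definition gen y : 'M[R]_2 :=
  if visit_time y is Some k then step k (it (- k) y) else hyp_diag.

Let L_gt0 : 0 < L. Proof. exact: lt_trans L_gt1. Qed.
Let L_neq0 : L != 0. Proof. by rewrite gt_eqF. Qed.

Lemma ratio_gt0 m : 0 < ratio m.
Proof. by rewrite divr_gt0. Qed.

Lemma det_step k z : \det (step k z) = 1.
Proof.
have Lq m : L * ratio m != 0 by rewrite mulf_neq0 // gt_eqF // ratio_gt0.
by case: k => [[|m]|m] /=; rewrite det_mx22 ?mulfV // ?mulr0 ?mul0r ?subr0 //
  sub0r mulN1r opprK.
Qed.

Lemma det_gen y : \det (gen y) = 1.
Proof.
rewrite /gen; case: visit_time => [k|]; first exact: det_step.
by rewrite det_mx22 mulfV // mul0r subr0.
Qed.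

Lemma gen_SL y : gen y \in SLpm2 R.
Proof. by apply/mem_set; left; exact: det_gen. Qed.

Definition generator y : SLpm2 R := exist _ (gen y) (gen_SL y).

(* [frame r k] conjugates [gen] to [hyp_diag] along the window of a visit to
   [V r `\` V r.+1]; its columns are the expanding and contracting vectors. *)
Definition frame (r : nat) (k : int) : 'M[R]_2 :=
  match k with
  | Posz 0 => mx22 r.+1%:R (r.+1%:R / L) 0 r.+1%:R^-1
  | Posz m.+1 => mx22 (m.+1%:R / r.+1%:R) 0
      (r.+1%:R / m.+1%:R * L ^- (m.*2).+1) (r.+1%:R / m.+1%:R)
  | Negz m => mx22 (r.+1%:R / m.+2%:R)
      (if m.+1 == r then 0 else r.+1%:R / m.+2%:R * L ^- (m.*2).+3)
      0 (m.+2%:R / r.+1%:R)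
  end.

(** This is the purpose of the case distinction in [frame]: windows open with the identity, the
    frame used outside all windows. *)
Lemma frame_start r : (0 < r)%N -> frame r (- r%:Z) = 1%:M.
Proof.
case: r => // r _; rewrite -NegzE /= eqxx -mx22_1.
by rewrite divff // pnatr_eq0.
Qed.

(** The shear at time -r creates the upper right entry of the frame, [tilt] cancels it at the visit,
    where a lower left entry appears, and the shear at time r removes that one. *)
Lemma frame_step r k z : (0 < r)%N -> (`|k| <= r)%N -> z <> x ->
  V r z -> ~ V r.+1 z ->
  step k z *m frame r k =
  (if k == r then 1%:M else frame r (k + 1)) *m hyp_diag.
Proof.
move=> r0 kr zx Vr nVr.
have Lp n : L ^+ n != 0 by rewrite expf_neq0.
case: k kr => [[|m]|m] kr.
(* The upper right entry of the left side is (L * tilt)(r+1)/L - 1/(r+1), and (r+1)^-2 is the value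
   of [tilt] that makes it vanish. *)
- rewrite /= /tilt asboolF // (rank_eq Vr nVr).
  rewrite (_ : 0%Z == r%:Z = false); last by apply/negbTE; lia.
  rewrite /hyp_diag !mx22_mul double0.
  by congr mx22; field; rewrite ?L_neq0 ?nat1rD_neq0 ?natrD_neq0.
- rewrite [_ == _](eqz_nat m.+1 r) /=; case: eqP => [mr|mr].
    rewrite /hook asboolF; last by rewrite mr.
    rewrite -mr doubleS /hyp_diag mul1mx !mx22_mul /ratio !exprS.
    set P := L ^+ _; have P0 : P != 0 by exact: Lp.
    by congr mx22; field; rewrite ?L_neq0 ?nat1rD_neq0 ?natrD_neq0 ?P0.
  rewrite /hook asboolT; last first.
    by apply: isolating_decr isoV _ _ _ _ Vr; move: kr => /=; lia.
  rewrite addn1 doubleS /hyp_diag !mx22_mul /ratio !exprS.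
  set P := L ^+ _; have P0 : P != 0 by exact: Lp.
  by congr mx22; field; rewrite ?L_neq0 ?nat1rD_neq0 ?natrD_neq0 ?P0.
- rewrite (_ : Negz m == r%:Z = false) //.
  have -> : (Negz m + 1) = - m%:Z by rewrite NegzE; lia.
  (* Time -1 is separate: the next frame is the one at time 0, which has its own clause. *)
  case: m kr => [|m] kr.
    rewrite /= /hook; case: (eqVneq 1%N r) => [r1|r1].
      rewrite asboolF; last by rewrite r1.
      rewrite -r1 /hyp_diag !mx22_mul /ratio !exprS expr0.
      by congr mx22; field; rewrite ?L_neq0 ?nat1rD_neq0 ?natrD_neq0.
    rewrite asboolT; last first.
      by apply: isolating_decr isoV _ _ _ _ Vr; move: kr r1 => /=; lia.
    rewrite /hyp_diag !mx22_mul /ratio !exprS expr0.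
    by congr mx22; field; rewrite ?L_neq0 ?nat1rD_neq0 ?natrD_neq0.
  rewrite -NegzE /= /hook (_ : m.+1 == r = false); last first.
    by apply/negbTE; move: kr => /=; lia.
  case: (eqVneq m.+2 r) => [r1|r1].
    rewrite asboolF; last by rewrite r1.
    rewrite -r1 !doubleS /hyp_diag !mx22_mul /ratio !exprS.
    set P := L ^+ _; have P0 : P != 0 by exact: Lp.
    by congr mx22; field; rewrite ?L_neq0 ?nat1rD_neq0 ?natrD_neq0 ?P0.
  rewrite asboolT; last first.
    by apply: isolating_decr isoV _ _ _ _ Vr; move: kr r1 => /=; lia.
  rewrite !doubleS /hyp_diag !mx22_mul /ratio !exprS.
  set P := L ^+ _; have P0 : P != 0 by exact: Lp.
  by congr mx22; field; rewrite ?L_neq0 ?nat1rD_neq0 ?natrD_neq0 ?P0.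
Qed.

(** * Conjugacy to the constant diagonal cocycle away from the orbit of [x] *)

Definition off_orbit y := forall k, it k y <> x.

Definition in_window y (k : int) (r : nat) :=
  [/\ (0 < r)%N, (`|k| <= r)%N, V r (it (- k) y) & ~ V r.+1 (it (- k) y)].

Lemma in_window_time y k r : in_window y k r ->
  visit_time y = Some k /\ rank (it (- k) y) = r.
Proof.
move=> [r0 kr Vr nVr]; split; last exact: rank_eq.
apply/visit_timeP; apply: isolating_decr isoV _ _ _ _ Vr.
by rewrite geq_max r0.
Qed.

Lemma visit_in_window y k : off_orbit y -> visit_time y = Some k ->
  in_window y k (rank (it (- k) y)).
Proof.
move=> oy /visit_timeP vk.
have [kr Vr nVr] := rankP vk (oy _).
by split => //; move: kr; rewrite geq_max => /andP[].
Qed.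

Lemma in_window_next y k r : in_window y k r -> (k < r)%R ->
  in_window (T y) (k + 1) r.
Proof.
move=> [r0 kr Vr nVr] ltkr.
have e : it (- (k + 1)) (T y) = it (- k) y.
  by rewrite -homeo_iterSr; congr (it _ y); lia.
by split; rewrite ?e //; lia.
Qed.

Lemma in_window_prev y k r : in_window (T y) k r -> (- r%:Z < k)%R ->
  in_window y (k - 1) r.
Proof.
move=> [r0 kr Vr nVr] ltkr.
have e : it (- (k - 1)) y = it (- k) (T y).
  by rewrite -homeo_iterSr; congr (it _ y); lia.
by split; rewrite ?e //; lia.
Qed.

Lemma off_orbitS y : off_orbit y -> off_orbit (T y).
Proof. by move=> oy k; rewrite -homeo_iterSr. Qed.

Lemma off_orbit_iter n y : off_orbit y -> off_orbit (iter n T y).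
Proof. by move=> oy; elim: n => //= n; exact: off_orbitS. Qed.

Definition frame_at y : 'M[R]_2 :=
  if visit_time y is Some k then frame (rank (it (- k) y)) k else 1%:M.

(* One more than the time elapsed since the current window opened. *)
Definition age y : nat :=
  if visit_time y is Some k then (`|k + (rank (it (- k) y))%:Z|).+1 else 1.

(** If [y] is outside all windows or at the end of one, then [T y] is outside or at the first time
    of a new one; a later time would put [y] inside the same window, before its end. *)
Lemma window_start y : off_orbit y ->
  (forall k r, in_window y k r -> k = r%:Z) -> frame_at (T y) = 1%:M /\ age (T y) = 1%N.
Proof.
move=> oy hy; rewrite /frame_at /age.
case E: (visit_time (T y)) => [k|//].
have w := visit_in_window (off_orbitS oy) E; move: w.
set r := rank _ => w; have [r0 kr _ _] := w.
have [ltk|lek] := ltP (- r%:Z)%R k; last first.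
  have -> : k = - r%:Z by lia.
  by rewrite frame_start // addNr.
have w' := in_window_prev w ltk.
by have := hy _ _ w'; lia.
Qed.

(** The conjugacy relation: inside a window it is [frame_step], and when a window closes or [y] lies
    in none, the frame at [T y] is the identity. *)
Lemma gen_frame_at y : off_orbit y -> gen y *m frame_at y = frame_at (T y) *m hyp_diag.
Proof.
move=> oy; case E: (visit_time y) => [k|].
  have w := visit_in_window oy E; have [r0 kr Vr nVr] := w.
  rewrite /gen {1}/frame_at E (frame_step r0 kr _ Vr nVr) //.
  move: w; set r := rank _ in r0 kr Vr nVr * => w.
  congr (_ *m _); case: eqP => [kE|kE].
    have [|-> //] := window_start oy; move=> k' r' w'.
    have [Ek' rk'] := in_window_time w'; move: Ek'; rewrite E => -[kk'].
    by rewrite -rk' -kk'.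
  have w' : in_window (T y) (k + 1) r by apply: in_window_next => //; lia.
  by rewrite /frame_at; have [-> ->] := in_window_time w'.
rewrite /gen {1}/frame_at E mulmx1.
have [|-> _] := window_start oy; last by rewrite mul1mx.
by move=> k r /in_window_time[]; rewrite E.
Qed.

Lemma ageS y : off_orbit y -> (age (T y) <= (age y).+1)%N.
Proof.
move=> oy; case E: (visit_time y) => [k|].
  have w := visit_in_window oy E; have [r0 kr Vr nVr] := w.
  move: w; set r := rank _ in r0 kr Vr nVr * => w.
  have [kE|kE] := eqVneq k r%:Z.
    have [|_ -> //] := window_start oy; move=> k' r' w'.
    have [Ek' rk'] := in_window_time w'; move: Ek'; rewrite E => -[kk'].
    by rewrite -rk' -kk'.
  have w' : in_window (T y) (k + 1) r by apply: in_window_next => //; lia.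
  rewrite /age; have [-> ->] := in_window_time w'.
  by rewrite E -/r; lia.
have [|_ -> //] := window_start oy.
by move=> k r /in_window_time[]; rewrite E.
Qed.

Lemma age_iter n y : off_orbit y -> (age (iter n T y) <= age y + n)%N.
Proof.
move=> oy; elim: n => [|n IH]; first by rewrite addn0.
by rewrite iterS (leq_trans (ageS (off_orbit_iter oy))) // addnS ltnS.
Qed.

(** * Size of the frames and growth of the cocycle *)

Lemma det_frame r k : \det (frame r k) = 1.
Proof.
case: k => [[|m]|m] /=; rewrite det_mx22 ?mulr0 ?mul0r subr0; field;
  by rewrite ?nat1rD_neq0 ?natrD_neq0.
Qed.

Lemma det_frame_at y : \det (frame_at y) = 1.
Proof. by rewrite /frame_at; case: visit_time => [k|]; rewrite ?det_frame ?det1. Qed.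

(** The bound involves only the time since the window opened. Since that time grows by at most one
    per step, frames grow at most linearly along an orbit although depths are unbounded. *)
Lemma frame_norm r k : (`|k| <= r)%N -> `|frame r k| <= (`|k + r%:Z|).+1%:R.
Proof.
move=> kr.
have Lp n : 0 <= L ^- n <= 1.
  have p1 : 1 <= L ^+ n by rewrite exprn_ege1 // ltW.
  by rewrite invr_ge0 invf_le1 ?p1 ?(le_trans _ p1) // (lt_le_trans _ p1).
have Lp1 : 0 <= L^-1 <= 1 by rewrite -[L]expr1.
have ge0n n : 0 <= n%:R :> R by [].
case: k kr => [[|m]|m] kr; rewrite [frame _ _]/=.
- rewrite add0r absz_nat; apply: mx22_norm_le; rewrite ?normr0 //.
  + by rewrite ger0_norm.
  + by rewrite ger0_norm ?divr_ge0 ?(ltW L_gt0) // ler_piMr //; case/andP: Lp1.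
  + rewrite ger0_norm ?invr_ge0 //; apply: (@le_trans _ _ 1).
      by rewrite invf_le1 // ler1n.
    by rewrite ler1n.
- have q0 : 0 <= r.+1%:R / m.+1%:R :> R by rewrite divr_ge0.
  have q1 : r.+1%:R / m.+1%:R <= r.+1%:R :> R.
    by rewrite ler_piMr // invf_le1 // ler1n.
  have q2 : m.+1%:R / r.+1%:R <= 1 :> R.
    by rewrite ler_pdivrMr // mul1r ler_nat; move: kr => /=; lia.
  apply: (@le_trans _ _ r.+1%:R); last by rewrite ler_nat; lia.
  have /andP[l0 l1] := Lp (m.*2).+1.
  apply: mx22_norm_le;
    rewrite ?normr0 // ger0_norm ?mulr_ge0 ?divr_ge0 ?invr_ge0 ?exprn_ge0 ?(ltW L_gt0) //.
  + by apply: (le_trans q2); rewrite ler1n.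
  + by apply: le_trans q1; rewrite ler_piMr.
- have q0 : 0 <= r.+1%:R / m.+2%:R :> R by rewrite divr_ge0.
  have aE : `|Negz m + r%:Z|.+1 = (r - m)%N.
    by rewrite NegzE; move: kr => /=; lia.
  have mr : (m < r)%N by move: kr => /=; lia.
  (* With d = r - m - 1 this reads d + m + 2 <= (d + 1)(m + 2). *)
  have q1 : r.+1%:R / m.+2%:R <= (r - m)%:R :> R.
    rewrite ler_pdivrMr // -natrM ler_nat.
    have -> : r = ((r - m.+1) + m.+1)%N by lia.
    set d := (_ - m.+1)%N; have -> : (d + m.+1 - m = d.+1)%N by lia.
    by nia.
  have q2 : m.+2%:R / r.+1%:R <= 1 :> R.
    by rewrite ler_pdivrMr // mul1r ler_nat.
  have /andP[l0 l1] := Lp (m.*2).+3.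
  rewrite aE; apply: mx22_norm_le; rewrite ?normr0 //.
  + by rewrite ger0_norm.
  + case: ifP => _; first by rewrite normr0.
    by rewrite ger0_norm ?mulr_ge0 //; apply: le_trans q1; rewrite ler_piMr.
  + rewrite ger0_norm ?divr_ge0 //; apply: (le_trans q2).
    by rewrite ler1n subn_gt0.
Qed.

Lemma frame_at_norm y : off_orbit y -> `|frame_at y| <= (age y)%:R.
Proof.
move=> oy; rewrite /frame_at /age; case E: (visit_time y) => [k|]; last first.
  by rewrite -mx22_1; apply: mx22_norm_le; rewrite ?normr0 ?normr1.
by have [_ kr _ _] := visit_in_window oy E; exact: frame_norm.
Qed.

Lemma hyp_diagX n : hyp_diag ^+ n = mx22 (L ^+ n) 0 0 (L ^- n).
Proof.
elim: n => [|n IH]; first by rewrite !expr0 invr1 mx22_1.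
rewrite exprS IH [_ * _]mx22_mul !mulr0 !mul0r !addr0 !add0r.
by rewrite -exprS -invfM -exprS.
Qed.

Lemma cocycle_frame_at n y : off_orbit y ->
  cocycle_nat T generator n y *m frame_at y = frame_at (iter n T y) *m hyp_diag ^+ n.
Proof.
move=> oy; elim: n => [|n IH]; first by rewrite /= expr0 mul1mx mulmx1.
rewrite [cocycle_nat _ _ _ _]/= -mulmxA IH mulmxA (gen_frame_at (off_orbit_iter oy)).
by rewrite -mulmxA exprS.
Qed.

(** The n-th product is C' D^n C^-1, with C and C' the frames at [y] and at its n-th iterate;
    solving for D^n gives the lower bound. *)
Lemma cocycle_growth y : off_orbit y ->
  exists2 K : R, 1 <= K & forall n,
    `|cocycle_nat T generator n y| <= K * n.+1%:R * L ^+ n /\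
    L ^+ n <= K * n.+1%:R * `|cocycle_nat T generator n y|.
Proof.
move=> oy; pose c : R := (age y)%:R.
have c1 : 1 <= c by rewrite ler1n /age; case: visit_time.
(* The 4 comes from the two multiplications of a triple product, one [c] from the frame at [y], and
   c (n+1) >= age y + n from the frame at time n. *)
exists (4 * c ^+ 2) => [|n]; first by nra.
have [N [_ CN Ny]] := mx22_unimodular_inv (det_frame_at y).
have [N' [CN' _ Ny']] := mx22_unimodular_inv (det_frame_at (iter n T y)).
have cE := cocycle_frame_at n oy.
set M := cocycle_nat _ _ _ _ in cE *.
have bC : `|frame_at y| <= c := frame_at_norm oy.
have bN : `|N| <= c := le_trans Ny bC.
have bC' : `|frame_at (iter n T y)| <= c * n.+1%:R.
  apply: (le_trans (frame_at_norm (off_orbit_iter oy))).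
  rewrite -natrM ler_nat; apply: (leq_trans (age_iter n oy)).
  by move: c1; rewrite ler1n; nia.
have bN' : `|N'| <= c * n.+1%:R := le_trans Ny' bC'.
have Ln1 : 1 <= L ^+ n by rewrite exprn_ege1 // ltW.
have bD : `|hyp_diag ^+ n| <= L ^+ n.
  rewrite hyp_diagX; apply: mx22_norm_le; rewrite ?normr0 ?ger0_norm //.
  - exact: le_trans Ln1.
  - exact: le_trans Ln1.
  - exact: le_trans Ln1.
  - by rewrite (le_trans _ Ln1) // invf_le1 // (lt_le_trans _ Ln1).
  - by rewrite invr_ge0 (le_trans _ Ln1).
have bD' : L ^+ n <= `|hyp_diag ^+ n|.
  apply: le_trans (mx_entry_le_norm _ 0 0).
  by rewrite hyp_diagX mxE /= ler_norm.
have norm3 (P Q S : 'M[R]_2) p q s : `|P| <= p -> `|Q| <= q -> `|S| <= s ->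
    `|P *m Q *m S| <= 4 * p * q * s.
  move=> hp hq hs.
  have p0 := le_trans (normr_ge0 _) hp.
  have q0 := le_trans (normr_ge0 _) hq.
  apply: (le_trans (mx22_normM _ _)).
  apply: ler_pM => //.
  have -> : 4 * p * q = 2 * (2 * p * q) by ring.
  rewrite ler_pM2l //; apply: (le_trans (mx22_normM _ _)).
  by apply: ler_pM; rewrite ?mulr_ge0 // ler_pM2l.
split.
  have -> : M = frame_at (iter n T y) *m hyp_diag ^+ n *m N.
    by rewrite -cE -mulmxA CN mulmx1.
  apply: (le_trans (norm3 _ _ _ _ _ _ bC' bD bN)).
  by rewrite le_eqVlt; apply/orP; left; apply/eqP; ring.
apply: (le_trans bD').
have -> : hyp_diag ^+ n = N' *m M *m frame_at y.
  by rewrite -mulmxA cE mulmxA CN' mul1mx.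
apply: (le_trans (norm3 _ _ _ _ _ _ bN' (lexx _) bC)).
by rewrite le_eqVlt; apply/orP; left; apply/eqP; ring.
Qed.

(** * Continuity of the generator *)

(** Near [x] the rank is large, so [tilt] is small. At any other point some [V r] is avoided,
    finitely many clopen conditions determine the rank, and [tilt] is locally constant. *)
Lemma tilt_continuous w (e : R) : 0 < e ->
  \forall z \near w, `|tilt w - tilt z| <= e.
Proof.
move=> e0; have [wx|wx] := pselect (w = x).
  have [N _ hN] : \forall n \near \oo, (n.+1%:R^-1 : R) < e.
    exact: near_infty_natSinv_lt (PosNum e0).
  have VN : nbhs w (V N).
    apply: open_nbhs_nbhs; split; first by case: (isolating_clopen isoV N).
    by rewrite wx; exact: isolating_mem isoV _.
  apply: filterS VN => z VNz; rewrite /tilt asboolT // sub0r normrN.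
  case: asboolP => [_|zx]; first by rewrite normr0 ltW.
  have [Nz _ _] := rankP VNz zx.
  rewrite ger0_norm ?invr_ge0 ?exprn_ge0 //.
  apply/ltW; apply: le_lt_trans (hN _ Nz).
  by rewrite lef_pV2 ?posrE ?exprn_gt0 // expr2 ler_peMl // ler1n.
have [r nVr] : exists r, ~ V r w.
  by apply: contrapT => /forallNP h; apply: wx; apply: (isolating_eq isoV) => r;
    apply: contrapT; exact: h.
have VVr : \forall z \near w, forall s, (s <= r)%N -> V s z <-> V s w.
  elim: {nVr} r => [|r IH].
    apply: filterS (clopen_near w (isolating_clopen isoV 0)) => z h s.
    by rewrite leqn0 => /eqP ->.
  apply: filterS2 IH (clopen_near w (isolating_clopen isoV r.+1)) => z h h' s.
  by rewrite leq_eqVlt => /orP[/eqP -> //|]; exact: h.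
apply: filterS VVr => z h.
have nVz : ~ V r z by move=> /(h r (leqnn r)).
have zx : z <> x by move=> zx; apply: nVz; rewrite zx; exact: isolating_mem isoV _.
have VE s : V s z <-> V s w.
  have [sr|rs] := leqP s r; first exact: h.
  by split=> /(isolating_decr isoV (ltnW rs)).
rewrite /tilt !asboolF // (_ : rank z = rank w) ?subrr ?normr0 ?ltW //.
congr (xget _ _); apply/seteqP; split=> s [a b]; split; first exact/VE.
- by move=> /VE.
- exact/VE.
- by move=> /VE.
Qed.

(** Uniformity in [z] matters: points near one without a visit may have visits, at large times and
    with arbitrary [z]. *)
Lemma step_tail (e : R) : 0 < e -> exists N, forall m z, (N <= m)%N ->
  `|step (Posz m.+1) z - hyp_diag| <= e /\ `|step (Negz m) z - hyp_diag| <= e.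
Proof.
move=> e0.
(* The first term bounds the error L/(m+1) of the diagonal entry, the second the shear, as [ratio m]
   is at most 2. *)
pose w (m : nat) : R := L * m.+1%:R^-1 + 2 * L^-1 ^+ m.
have w0 : w @ \oo --> (0 : R).
  rewrite -[0](addr0 (0 : R)); apply: cvgD.
    rewrite -[0](mulr0 L); apply: cvgM; first exact: cvg_cst.
    exact: cvg_harmonic.
  rewrite -[0](mulr0 (2 : R)); apply: cvgM; first exact: cvg_cst.
  by apply: cvg_expr; rewrite ger0_norm ?invr_ge0 ?ltW // invf_lt1.
have [N _ hN] : \forall m \near \oo, `|0 - w m| <= e.
  by move/cvgrPdist_le : w0; apply.
exists N => m z Nm.
have m2 : (m.+2 <= 2 * m.+1)%N by lia.
have mm : (m <= (m.+1).*2)%N by lia.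
have wm : w m <= e.
  by apply: le_trans (hN _ Nm); rewrite sub0r normrN ler_norm.
have t0 : 0 < L^-1 ^+ m by rewrite exprn_gt0 // invr_gt0.
have r0 : 0 < m.+1%:R^-1 :> R by rewrite invr_gt0.
have a1 : `|L * ratio m - L| <= e.
  have -> : L * ratio m - L = L * m.+1%:R^-1.
    rewrite /ratio -[m.+2%:R]natr1; field.
    by rewrite nat1r pnatr_eq0.
  rewrite ger0_norm; last by rewrite mulr_ge0 // ltW.
  apply: le_trans wm.
  by rewrite lerDl mulr_ge0 // ltW.
have Li : 0 < L^-1 <= 1 by rewrite invr_gt0 L_gt0 invf_le1 // ltW.
have a2 : `|(L * ratio m)^-1 - L^-1| <= e.
  have m0 : 0 <= m%:R :> R by [].
  have -> : (L * ratio m)^-1 - L^-1 = - (L^-1 * m.+2%:R^-1).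
    rewrite /ratio; field.
    by rewrite L_neq0 !gt_eqF //; lra.
  rewrite normrN ger0_norm; last by rewrite mulr_ge0 ?invr_ge0 // ltW.
  apply: le_trans wm; rewrite /w.
  have i2 : m.+2%:R^-1 <= m.+1%:R^-1 :> R by rewrite lef_pV2 ?posrE // ler_nat.
  have i0 : 0 < m.+2%:R^-1 :> R by rewrite invr_gt0.
  have s1 : L^-1 * m.+2%:R^-1 <= m.+2%:R^-1.
    by have /andP[_ l1] := Li; rewrite ler_piMl // ltW.
  have s2 : m.+1%:R^-1 <= L * m.+1%:R^-1 by rewrite ler_peMl // ltW.
  apply: (le_trans s1); apply: (le_trans i2); apply: (le_trans s2).
  by rewrite lerDl mulr_ge0 // ltW.
have a3 : `|hook m z| <= e.
  rewrite /hook; case: asboolP => _; first by rewrite normr0 ltW.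
  have q2 : ratio m <= 2 by rewrite ler_pdivrMr // -natrM ler_nat.
  have q0 := ratio_gt0 m.
  have h : L ^- (m.+1).*2 <= L^-1 ^+ m.
    rewrite exprVn lef_pV2 ?posrE ?exprn_gt0 //.
    by rewrite ler_weXn2l ?(ltW L_gt1).
  have h0 : 0 < L ^- (m.+1).*2 by rewrite invr_gt0 exprn_gt0.
  rewrite ger0_norm; last by rewrite mulr_ge0 // ltW.
  apply: le_trans wm; rewrite /w.
  have hq : L ^- (m.+1).*2 * ratio m <= L^-1 ^+ m * 2.
    by apply: ler_pM => //; exact: ltW.
  apply: (le_trans hq); rewrite mulrC lerDr.
  by rewrite mulr_ge0 // ltW.
by split; rewrite mx22B; apply: mx22_norm_le;
  rewrite ?subr0 ?normrN ?normr0 ?(ltW e0).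
Qed.

(** Having a visit at a given time is a clopen condition. A visit of [y] therefore persists nearby
    at the same time; without one, nearby points have visits only at times covered by
    [step_tail]. *)
Lemma gen_near y (e : R) : 0 < e -> \forall z \near y, `|gen y - gen z| <= e.
Proof.
move=> e0; case E: (visit_time y) => [k|]; last first.
  have [N hN] := step_tail e0.
  have far : \forall z \near y, forall k, (`|k| <= N)%N -> ~ visit z k.
    have nv := (visit_timeN y).1 E.
    have away k : \forall z \near y, ~ visit z k.
      have := near_homeo_iter (clopen_near (it (- k) y)
        (isolating_clopen isoV (maxn 1 `|k|))).
      by apply: filterS => z /= h /h; exact: nv.
    elim: {hN} N => [|N IH].
      by apply: filterS (away 0) => z nz k k0; have -> : k = 0 by lia.
    apply: filterS3 IH (away N.+1%:Z) (away (- N.+1%:Z)) => z h1 h2 h3 k kN.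
    have [->//|k1] := eqVneq k N.+1%:Z.
    have [->//|k2] := eqVneq k (- N.+1%:Z).
    by apply: h1; lia.
  apply: filterS far => z hz; rewrite /gen E.
  case Ez: (visit_time z) => [k|]; last by rewrite subrr normr0 ltW.
  have kN : (N < `|k|)%N.
    by rewrite ltnNge; apply/negP => /hz; apply; apply/visit_timeP.
  rewrite distrC; case: k kN {Ez} => [[|m]|m] kN //.
    by have [] := hN m (it (- m.+1%:Z) z); first by move: kN => /=; lia.
  by have [] := hN m (it (- Negz m) z); first by move: kN => /=; lia.
have vk : \forall z \near y, visit_time z = Some k.
  have := near_homeo_iter (clopen_near (it (- k) y)
    (isolating_clopen isoV (maxn 1 `|k|))).
  by apply: filterS => z /= h; apply/visit_timeP/h/visit_timeP.
suff : \forall w \near it (- k) y, `|step k (it (- k) y) - step k w| <= e.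
  move=> /near_homeo_iter /= h; apply: filterS2 vk h => z Ez.
  by rewrite /gen E Ez.
move: (it (- k) y) => {vk E} w0.
have hook_const m : \forall w \near w0, hook m w = hook m w0.
  apply: filterS (clopen_near w0 (isolating_clopen isoV m.+2)) => w h.
  by rewrite /hook (asbool_equiv_eq h).
case: k hook_const => [[|m]|m] hook_const.
- have eL : 0 < e / L by rewrite divr_gt0.
  apply: filterS (tilt_continuous _ eL) => w h.
  rewrite mx22B !subrr; apply: mx22_norm_le; rewrite ?normr0 ?(ltW e0) //.
  by rewrite -mulrBr normrM gtr0_norm // mulrC -ler_pdivlMr.
- by apply: filterS (hook_const m) => w h; rewrite /= h subrr normr0 ltW.
- by apply: filterS (hook_const m) => w h; rewrite /= h subrr normr0 ltW.
Qed.

Lemma generator_continuous : continuous generator.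
Proof.
apply: (@continuous_comp_initial _ _ _ (set_val : SLpm2 R -> 'M[R]_2)) => y.
by apply/cvgrPdist_le => e e0; exact: gen_near.
Qed.

(** * The orbit of [x] and the failure of uniform hyperbolicity *)

(** As [x] lies in every [V r], its whole orbit is a single infinite window. *)
Lemma gen_orbit k : gen (it k x) = step k x.
Proof.
have -> : gen (it k x) = if visit_time (it k x) is Some k' then
  step k' (it (- k') (it k x)) else hyp_diag by [].
have -> : visit_time (it k x) = Some k.
  apply/visit_timeP; rewrite /visit homeo_iterNK.
  exact: isolating_mem isoV _.
by rewrite homeo_iterNK.
Qed.

Lemma hook0 m : hook m x = 0.
Proof. by rewrite /hook asboolT //; exact: isolating_mem isoV _. Qed.

(** No shear acts on the orbit of [x], and the ratios telescope. *)
Lemma cocycle_after n :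
  cocycle_nat T generator n (T x) =
  mx22 (L ^+ n * n.+1%:R) 0 0 (L ^+ n * n.+1%:R)^-1.
Proof.
elim: n => [|n IH]; first by rewrite /= expr0 mulr1 invr1 mx22_1.
rewrite [LHS]/= IH -[T x]/(it 1 x).
have -> : iter n T (it 1 x) = it n.+1 x by rewrite -[LHS]/(iter n T (T x)) -iterSr.
rewrite gen_orbit /= hook0 oppr0 mx22_mul !mul0r !mulr0 !addr0 add0r.
have Ln : L ^+ n != 0 by rewrite expf_neq0.
by rewrite /ratio exprS; congr mx22; field; rewrite ?L_neq0 ?Ln ?nat1rD_neq0 ?natrD_neq0.
Qed.

Lemma cocycle_before m n : (n <= m)%N ->
  cocycle_nat T generator n (it (- m%:Z) x) =
  mx22 (L ^+ n * (m.+1%:R / (m - n).+1%:R)) 0 0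
       (L ^+ n * (m.+1%:R / (m - n).+1%:R))^-1.
Proof.
elim: n => [|n IH] nm.
  by rewrite /= expr0 subn0 divff ?pnatr_eq0 // mulr1 invr1 mx22_1.
rewrite [LHS]/= IH; last exact: ltnW.
have -> : iter n T (it (- m%:Z) x) = it (Negz (m - n.+1)) x.
  rewrite -[LHS]/(it n%:Z (it (- m%:Z) x)) -homeo_iterD NegzE.
  by congr (it _ x); lia.
rewrite gen_orbit /= hook0 mx22_mul !mul0r !mulr0 !addr0 add0r.
have Ln : L ^+ n != 0 by rewrite expf_neq0.
rewrite /ratio exprS; set d := (m - n.+1)%N.
have -> : (m - n = d.+1)%N by rewrite /d; lia.
by congr mx22; field; rewrite ?L_neq0 ?Ln ?nat1rD_neq0 ?natrD_neq0.
Qed.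

(* The expansion before the visit to [x] is undone by the contraction after. *)
Lemma cocycle_tangency m :
  cocycle T generator (m.*2).+1%:Z (it (- m%:Z) x) = mx22 0 (-1) 1 0.
Proof.
have -> : (m.*2).+1%:Z = m%:Z + (1 + m%:Z) by lia.
rewrite !cocycleD cocycle1 homeo_iterD !homeo_iterKN.
rewrite [cocycle _ _ _ (it 1 x)]cocycle_after.
rewrite [cocycle _ _ _ (it _ x)]cocycle_before // subnn divr1.
rewrite -[x in generator x]/(it 0 x) [\val _]gen_orbit /= /tilt asboolT //.
have Ln : L ^+ m != 0 by rewrite expf_neq0.
rewrite !mx22_mul.
by congr mx22; field; rewrite ?Ln ?nat1rD_neq0 ?natrD_neq0.
Qed.

(** By [cocycle_tangency] a product of norm at most 1 occurs at every odd time, so the forward lower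
    limit is at most 0. *)
Lemma generator_not_uh : ~ uniformly_hyperbolic T generator.
Proof.
move=> [+ _]; apply/negP; rewrite -leNgt limn_einf_lim.
apply: lime_le; first exact: is_cvg_einfs.
apply: nearW => n /=.
set u := (fun n : nat => _); apply: (@le_trans _ _ (u (n.*2).+1)).
  by apply: ereal_inf_lbound; exists (n.*2).+1 => //=; lia.
set v := ((n.*2).+1%:R^-1 * ln `|mx22 0 (-1) 1 0 : 'M[R]_2|)%:E.
apply: (@le_trans _ _ v).
  (* The odd time 2n+1 belongs to the tail of times from n on. *)
  apply: ereal_inf_lbound; exists (it (- n%:Z) x) => //.
  exact: (congr1 (fun M => ((n.*2).+1%:R^-1 * ln `|M|)%:E) (cocycle_tangency n)).
rewrite lee_fin mulr_ge0_le0 // ln_le0 //.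
by apply: mx22_norm_le; rewrite ?normr0 ?normrN ?normr1.
Qed.

Lemma generator_exponent y : off_orbit y ->
  (fun n : nat => n%:R^-1 * ln `|cocycle T generator n%:Z y|) @ \oo --> ln L.
Proof.
move=> /cocycle_growth[K K1 hK].
by apply: (ln_growth K1) => n; rewrite lnK ?posrE //; have [] := hK n.
Qed.

(** An orbit point is the intersection of the clopen preimages of the [V r]; closedness makes it a
    Borel set. *)
Lemma isolating_closed1 k : closed [set it k x].
Proof.
have -> : [set it k x] = \bigcap_r (it (- k) @^-1` V r).
  apply/seteqP; split=> [y -> r _ /=|y h /=].
    by rewrite homeo_iterNK; exact: isolating_mem isoV _.
  rewrite -(isolating_eq isoV (y := it (- k) y)) ?homeo_iterKN // => r.
  exact: h.
apply: closed_bigI => r _; apply: preimage_closed.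
  by move=> *; exact: homeo_iter_continuous.
by have [] := isolating_clopen isoV r.
Qed.
End Excursions.

(** * Invariant probabilities give no mass to an aperiodic orbit *)

Section WanderingOrbit.
Variables (R : realType) (X : ptopologicalType) (T : homeomorphism X) (x : X).
Hypothesis closed_orbit : forall k, closed [set homeo_iter T k x].
Hypothesis aperiodic : forall k, k != 0 -> homeo_iter T k x <> x.
Variables (mu : probability (borel X) R) (mu_inv : invariant_measure T mu).

Local Notation pt k := ([set homeo_iter T k x] : set (borel X)).

Lemma orbit_point_measurable k : measurable (pt k).
Proof.
rewrite -[pt k]setCK; apply: measurableC; apply: sub_sigma_algebra.
exact: closed_openC.
Qed.

Lemma orbit_point_invariant k : mu (pt (k + 1)) = mu (pt k).
Proof.
rewrite -(mu_inv (orbit_point_measurable (k + 1))); congr (mu _).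
apply/seteqP; split=> y /=; last by move=> ->; rewrite homeo_iterS.
by rewrite homeo_iterS => /(can_inj (homeo_funK T)).
Qed.

(** All orbit points have the same mass c, and any n of them are distinct with total mass at most 1,
    so n c <= 1 for every n. *)
Lemma orbit_point_null k : mu (pt k) = 0%E.
Proof.
have same j n : mu (pt (j + n%:Z)) = mu (pt j).
  elim: n => [|n <-]; first by rewrite addr0.
  by rewrite -[RHS]orbit_point_invariant; congr (mu [set homeo_iter T _ x]); lia.
have mE : mu (pt k) = (fine (mu (pt k)))%:E.
  by rewrite fineK // fin_num_measure //; exact: orbit_point_measurable.
have : 0 <= fine (mu (pt k)) by rewrite fine_ge0.
rewrite mE; set c := fine _ => c0; congr _%:E; apply/eqP.
rewrite eq_le c0 andbT leNgt; apply/negP => cpos.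
have bound n : c *+ n <= 1.
  have mF (i : 'I_n) : measurable (pt (k + i%:Z)) by exact: orbit_point_measurable.
  have mU : measurable (\big[setU/set0]_(i < n) pt (k + i%:Z)).
    by apply: bigsetU_measurable => i _; exact: mF.
  have := probability_le1 mu mU.
  rewrite measure_bigsetU_ord //; last first.
    move=> i j _ _ [y [/= -> e]]; apply/ord_inj/eqP; rewrite -eqz_nat -subr_eq0.
    apply: contrapT => /negP /aperiodic; apply.
    have -> : i%:Z - j%:Z = - (k + j%:Z) + (k + i%:Z) by lia.
    by rewrite homeo_iterD e homeo_iterNK.
  rewrite (eq_bigr (fun=> c%:E)); last by move=> i _; exact: etrans (same k i) mE.
  by rewrite sumEFin lee_fin sumr_const card_ord.
have := bound (Num.bound c^-1).
have : c^-1 < (Num.bound c^-1)%:R by rewrite archi_boundP // invr_ge0.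
by rewrite -(ltr_pM2l cpos) mulfV ?gt_eqF // mulr_natr => /lt_geF ->.
Qed.

Lemma orbit_negligible :
  mu.-negligible [set homeo_iter T k x | k in [set: int]].
Proof.
apply: (@negligibleS _ _ _ mu (\bigcup_n pt n%:Z `|` \bigcup_n pt (- n%:Z))).
  move=> _ [k _ <-]; case: (intP k) => [|n|n].
  - by left; exists 0%N.
  - by left; exists n.+1.
  - by right; exists n.+1.
by apply: negligibleU; apply: negligible_bigcup => n;
  apply/negligibleP; [exact: orbit_point_measurable|exact: orbit_point_null
                     |exact: orbit_point_measurable|exact: orbit_point_null].
Qed.

End WanderingOrbit.

(** * The cocycle over a system with an isolating sequence *)

Lemma isolating_monochromatic (R : realType) (X : ptopologicalType)
    (T : homeomorphism X) (x : X) (V : nat -> set X) (isoV : isolating T x V)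
    (lambda0 : R) (lambda0_gt0 : 0 < lambda0) :
  exists A : X -> SLpm2 R,
    [/\ continuous A, monochromatic_with T A lambda0 & ~ uniformly_hyperbolic T A].
Proof.
have L1 : 1 < expR lambda0 by rewrite expR_gt1.
exists (generator T x V L1); split.
- exact: generator_continuous.
- move=> mu [inv_mu _].
  (* The exceptional set is covered by a null set containing the orbit of [x]; every other point has
     exponent ln L = lambda0. *)
  have [B [mB B0 sB]] := orbit_negligible (isolating_closed1 isoV)
    (isolating_orbit isoV) inv_mu.
  exists B; split => // y ny; apply: sB; apply: contrapT => oy; apply: ny => /=.
  have off : off_orbit T x y.
    by move=> k kx; apply: oy; exists (- k); rewrite // -kx homeo_iterNK.
  by have := generator_exponent isoV L1 off; rewrite expRK.
- exact: generator_not_uh.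
Qed.

(** * Symbolic dynamics: a point with a word that occurs only once *)

Section Occurrences.
Variables (S : finType) (F : seq (seq S)).
Implicit Types x y z : full_shift S.

Definition max_forbidden := \max_(w <- F) size w.

Lemma sft_full_translate a x : sft F x -> sft F (full_translate a x).
Proof. by move=> Fx; apply/set_mem/sft_translate/mem_set. Qed.

(** Gluing the letters at 0 works because each block of [max_forbidden] letters of the glued point
    appears in some [q i], so no forbidden word can occur. *)
Lemma sft_pseudo_orbit (q : int -> full_shift S) :
  (forall i, sft F (q i)) ->
  (forall i (j : nat), (j < max_forbidden)%N -> q i j.+1%:Z = q (i + 1) j%:Z) ->
  exists2 x, sft F x &
    forall i (j : nat), (j <= max_forbidden)%N -> x (i + j%:Z) = q i j%:Z.
Proof.
move=> Fq qS; pose x : full_shift S := fun i => q i 0.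
have xq i (j : nat) : (j <= max_forbidden)%N -> x (i + j%:Z) = q i j%:Z.
  elim: j i => [|j IH] i jn; first by rewrite addr0.
  by rewrite qS // -IH ?(ltnW jn) //; congr (x _); lia.
exists x => // w Fw i xw; apply: (Fq i w Fw 0); rewrite -[RHS]xw.
apply/eq_in_map => j; rewrite mem_iota add0n => /andP[_ jw].
rewrite add0r xq //; apply: ltnW; rewrite (leq_trans jw) // /max_forbidden.
exact: leq_bigmax_seq.
Qed.

(** Otherwise every block of length [max_forbidden] determines all letters to its right, and by
    pigeonhole the subshift would be finite. *)
Lemma sft_branching : infinite_set (sft F) ->
  exists y y', [/\ sft F y, sft F y',
    forall j : nat, (j < max_forbidden)%N -> y j%:Z = y' j%:Z &
    y max_forbidden%:Z <> y' max_forbidden%:Z].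
Proof.
move=> infF; apply: contrapT => nb.
have det y y' : sft F y -> sft F y' ->
    (forall j : nat, (j < max_forbidden)%N -> y j%:Z = y' j%:Z) ->
    forall n : nat, y n%:Z = y' n%:Z.
  move=> Fy Fy' yy'; elim/ltn_ind => n IH.
  have [/yy'//|on] := ltnP n max_forbidden.
  apply: contrapT => ne; apply: nb.
  pose a := (n - max_forbidden)%N.
  exists (full_translate a%:Z y), (full_translate a%:Z y'); split.
  - exact: sft_full_translate.
  - exact: sft_full_translate.
  - move=> j jo; rewrite /full_translate -PoszD; apply: IH.
    by rewrite /a; lia.
  - by rewrite /full_translate -PoszD /a subnKC.
(* More points are taken than there are words of length [max_forbidden]. *)
have [B BF] := infinite_set_fset #|{ffun 'I_max_forbidden -> S}|.+1 infF.
apply/negP; rewrite -ltnNge ltnS.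
(* Two distinct points differ at some coordinate not left of -n. The maximum [N] of these n serves
   all pairs, so the words starting at -N separate the points of [B]. *)
have sep (p : B * B) : exists n : nat, val p.1 <> val p.2 ->
    exists i : nat, (val p.1) (i%:Z - n%:Z) <> (val p.2) (i%:Z - n%:Z).
  have [->|ne] := pselect (val p.1 = val p.2); first by exists 0%N.
  have [i ni] : exists i, (val p.1) i <> (val p.2) i.
    by apply: contrapT => /forallNP h; apply: ne; apply: funext => i;
      apply: contrapT; exact: h.
  exists (absz i) => _; exists (absz (i + (absz i)%:Z)).
  by have -> : (absz (i + (absz i)%:Z))%:Z - (absz i)%:Z = i by lia.
have [f hf] := choice sep.
pose N := (\max_p f p)%N.
pose g (b : B) := [ffun j : 'I_max_forbidden => (val b : full_shift S) (j%:Z - N%:Z)].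
have g_inj : injective g.
  move=> b b' /ffunP gbb'; apply: val_inj; apply: contrapT => ne.
  have [i ni] := hf (b, b') ne; apply: ni.
  have fN : (f (b, b') <= N)%N by exact: leq_bigmax.
  have Fb (c : B) : sft F (full_translate (- N%:Z) (val c)).
    by apply: sft_full_translate; apply: BF; exact: valP.
  have := det _ _ (Fb b) (Fb b') _ (i + (N - f (b, b')))%N.
  rewrite /full_translate.
  have -> : (i + (N - f (b, b')))%N%:Z - N%:Z = i%:Z - (f (b, b'))%:Z by lia.
  apply => j jo; have := gbb' (Ordinal jo).
  by rewrite !ffunE.
by rewrite cardfE; exact: leq_card g_inj.
Qed.

(** The bounds differ on purpose: the start shows the full word, with the branching letter, while
    the return is only to the prefix shared by both branches. *)
Definition returns_in y (k : nat) := exists z, [/\ sft F z,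
  forall j : nat, (j <= max_forbidden)%N -> z j%:Z = y j%:Z &
  forall j : nat, (j < max_forbidden)%N -> z (k%:Z + j%:Z) = y j%:Z].

Definition occurs_once x (n : nat) := forall i,
  (forall j : nat, (j < n)%N -> x (i + j%:Z) = x j%:Z) -> i = 0.

(** A second occurrence at i would be a return after |i| steps, of [y] itself for i > 0 and of its
    translate by i for i < 0. *)
Lemma no_return_occurs_once y : sft F y ->
  (forall k, (0 < k)%N -> ~ returns_in y k) -> occurs_once y max_forbidden.+1.
Proof.
move=> Fy nret i yi; case: (ltgtP i 0) => // i0.
  case: (nret `|i|%N); first lia.
  exists (full_translate i y); split; first exact: sft_full_translate.
    by move=> j jo; rewrite /full_translate addrC yi.
  move=> j jo; rewrite /full_translate; congr (y _); lia.
case: (nret `|i|%N); first lia.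
exists y; split=> // j jo; rewrite -[RHS]yi; last exact: ltnW.
by congr (y _); lia.
Qed.

Lemma min_return y k : (0 < k)%N -> returns_in y k ->
  exists k', [/\ (0 < k')%N, returns_in y k' &
    forall l, (0 < l < k')%N -> ~ returns_in y l].
Proof.
move=> k0 rk.
have ex : exists k, (0 < k)%N && `[< returns_in y k >].
  by exists k; rewrite k0; apply/asboolP.
have [k' /andP[k'0 /asboolP rk'] kmin] := ex_minnP ex.
exists k'; split => // l /andP[l0 lk'] rl.
have : (k' <= l)%N by apply: kmin; rewrite l0; apply/asboolP.
by rewrite leqNgt lk'.
Qed.

(* Two words with a common prefix of length [max_forbidden] and distinct last
   letters: either one of them cannot return to the prefix, and then occurs only
   once in any point containing it, or two shortest loops [c], [c'] at the prefix
   give the homoclinic point [... c c c' c c ...], where the second word starts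
   only at the beginning of [c']. *)
Lemma sft_occurs_once : infinite_set (sft F) ->
  exists2 x, sft F x & occurs_once x max_forbidden.+1.
Proof.
move=> /sft_branching[y [y' [Fy Fy' yy' neq]]].
have [[k k0 rk]|nr] := pselect (exists2 k, (0 < k)%N & returns_in y k); last first.
  exists y => //; apply: no_return_occurs_once => // k k0 rk.
  by apply: nr; exists k.
have [[k' k'0 rk']|nr] := pselect (exists2 k, (0 < k)%N & returns_in y' k);
    last first.
  exists y' => //; apply: no_return_occurs_once => // l l0 rl.
  by apply: nr; exists l.
have {k k0 rk}[k [k0 [z [Fz zy zk]] kmin]] := min_return k0 rk.
have {k' k'0 rk'}[k' [k'0 [z' [Fz' zy' zk']] kmin']] := min_return k'0 rk'.
(* The periodic pseudo-orbit of the loop c, at phase m modulo [k]. *)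
pose loop (m : int) := full_translate (m %% k%:Z)%Z z.
have loopS m (j : nat) : (j < max_forbidden)%N ->
    loop m j.+1%:Z = loop (m + 1) j%:Z.
  move=> jo; rewrite /loop /full_translate -modzDml.
  set a := (m %% k)%Z.
  have a0 : (0 <= a)%R by rewrite modz_ge0; lia.
  have ak : (a < k%:Z)%R by rewrite ltz_pmod; lia.
  have [ek|nk] := eqVneq (a + 1) k%:Z.
    rewrite ek modzz addr0 zy ?(ltnW jo) // -zk //.
    by congr (z _); lia.
  rewrite modz_small; last by lia.
  by congr (z _); lia.
(* The loop c' occupies the times from 0 to k'-1, with copies of c on both sides. *)
pose q (i : int) := if (i < 0)%R then loop i else
  if (i < k'%:Z)%R then full_translate i z' else loop (i - k'%:Z).
have loop0 m (j : nat) : (j <= max_forbidden)%N -> (m %% k%:Z)%Z = 0 ->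
    loop m j%:Z = y j%:Z.
  by move=> jo m0; rewrite /loop /full_translate m0 addr0 zy.
have [] := @sft_pseudo_orbit q.
- by move=> i; rewrite /q; do 2?case: ifP => _; exact: sft_full_translate.
- move=> i j jo; rewrite /q.
  have [i0|i0] := ltP i 0.
    have [i1|i1] := ltP (i + 1) 0; first exact: loopS.
    have -> : i + 1 = 0 by lia.
    rewrite (_ : (0 < k'%:Z)%R = true); last by lia.
    rewrite loopS // (_ : i + 1 = 0); last by lia.
    by rewrite loop0 ?(ltnW jo) ?mod0z // /full_translate /= addr0 zy' ?(ltnW jo) // yy'.
  rewrite (_ : (i + 1 < 0)%R = false); last by lia.
  have [ik|ik] := ltP i k'%:Z; last first.
    rewrite (_ : (i + 1 < k'%:Z)%R = false); last by lia.
    by rewrite loopS //; congr (loop _ _); lia.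
  have [i1|i1] := ltP (i + 1) k'%:Z.
    by rewrite /full_translate; congr (z' _); lia.
  rewrite (_ : i + 1 - k'%:Z = 0); last by lia.
  rewrite loop0 ?(ltnW jo) ?mod0z // yy' // -zk' // /full_translate.
  by congr (z' _); lia.
move=> x Fx xq; exists x => // i xi.
have qi (j : nat) : (j <= max_forbidden)%N -> q i j%:Z = y' j%:Z.
  move=> jo; rewrite -xq // xi // -[j%:Z]add0r xq // /q.
  rewrite ltxx (_ : (0 < k'%:Z)%R = true); last by lia.
  by rewrite /full_translate addr0 zy'.
(* At phase 0 the last letter is the wrong one; at any other phase there would be a return shorter
   than [k]. *)
have loopN m : ~ (forall j : nat, (j <= max_forbidden)%N -> loop m j%:Z = y' j%:Z).
  move=> h; have a0 : (0 <= (m %% k)%Z)%R by rewrite modz_ge0; lia.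
  have ak : ((m %% k)%Z < k%:Z)%R by rewrite ltz_pmod; lia.
  have [m0|m0] := eqVneq (m %% k)%Z 0.
    by apply: neq; rewrite -h // loop0.
  apply: (kmin `|(m %% k)%Z|%N); first by lia.
  exists z; split=> // j jo; rewrite yy' // -h ?(ltnW jo) //.
  rewrite /loop /full_translate; congr (z _); lia.
move: qi; rewrite /q; case: ltP => [_ /loopN//|i0].
case: ltP => [ik h|_ /loopN//].
apply: contrapT => ni; apply: (kmin' `|i|%N); first by lia.
exists z'; split=> // j jo; rewrite -h ?(ltnW jo) //.
by rewrite /full_translate; congr (z' _); lia.
Qed.

End Occurrences.

(** * Cylinders as isolating neighbourhoods *)

Section Cylinders.
Variables (S : finType) (F : seq (seq S)) (ne : sft F !=set0).

Lemma sft_shift_iter k (y : sft_space ne) i :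
  \val (homeo_iter (sft_shift ne) k y) i = \val y (i + k).
Proof.
elim/int_rect: k i => [|n IH|n IH] i; first by rewrite addr0.
- have -> : n.+1%:Z = n%:Z + 1 by lia.
  by rewrite homeo_iterS sft_shiftE IH; congr (\val y _); lia.
- have -> : i = (i - 1) + 1 by lia.
  rewrite -[LHS]sft_shiftE -homeo_iterS.
  have -> : - n.+1%:Z + 1 = - n%:Z by lia.
  by rewrite IH; congr (\val y _); lia.
Qed.

Definition cylinder (x : sft_space ne) (n : nat) : set (sft_space ne) :=
  [set y | forall i : int, (`|i| <= n)%N -> \val y i = \val x i].

Lemma near_coord (y : sft_space ne) i :
  \forall z \near y, \val z i = \val y i.
Proof.
have cont : continuous (fun z : sft_space ne => \val z i : discrete_topology S).
  move=> z; apply: (@continuous_comp _ _ _ set_val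
    (fun u : full_shift S => u i : discrete_topology S)).
    exact: (@initial_continuous (sft F) (full_shift S) set_val).
  exact: (@proj_continuous int (fun=> discrete_topology S) i).
exact: (cont y _ (discrete_set1 (\val y i : discrete_topology S))).
Qed.

Lemma near_cylinder (y : sft_space ne) n : \forall z \near y, cylinder y n z.
Proof.
elim: n => [|n IH].
  by apply: filterS (near_coord y 0) => z zy i i0; have -> : i = 0 by lia.
apply: filterS3 IH (near_coord y n.+1%:Z) (near_coord y (- n.+1%:Z)).
move=> z h1 h2 h3 i ni.
have [->//|i1] := eqVneq i n.+1%:Z.
have [->//|i2] := eqVneq i (- n.+1%:Z).
by apply: h1; lia.
Qed.

Lemma cylinder_clopen (x : sft_space ne) n : clopen (cylinder x n).
Proof.
split; last rewrite -openC; rewrite openE => y; rewrite /interior /=.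
  by move=> xy; apply: filterS (near_cylinder y n) => z zy i ni;
    rewrite zy // xy.
move=> nxy; apply: filterS (near_cylinder y n) => z zy xz; apply: nxy => i ni.
by rewrite -zy // xz.
Qed.

(** The radius 2r + n covers the block of length n at any time |k| <= 2r. If the k-th iterate is in
    the cylinder of index 1, this block of [x] repeats its block at 0, hence k = 0. *)
Lemma occurs_once_isolating (x : sft_space ne) n : occurs_once (\val x) n ->
  isolating (sft_shift ne) x (fun r => cylinder x (r.*2 + n)).
Proof.
move=> ox; split.
- by move=> r; exact: cylinder_clopen.
- by move=> r s rs y ys i ir; apply: ys; lia.
- by [].
- move=> y yx; apply: val_inj; apply: funext => i.
  by apply: (yx `|i|%N); lia.
- move=> r k y k0 kr yr ky; move/eqP: k0; apply; apply: ox => j jn.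
  rewrite -(ky j%:Z); last by rewrite /=; lia.
  by rewrite sft_shift_iter addrC yr //; lia.
Qed.

End Cylinders.

Theorem theorem1p3 (R : realType) (S : finType) (F : seq (seq S))
    (ne : sft F !=set0) (infX : infinite_set (sft F))
    (lambda0 : R) (lambda0_gt0 : 0 < lambda0) :
  exists A : sft_space ne -> SLpm2 R,
    [/\ continuous A,
        monochromatic_with (sft_shift ne) A lambda0 &
        ~ uniformly_hyperbolic (sft_shift ne) A].
Proof.
have [x Fx ox] := sft_occurs_once infX.
have ox' : occurs_once (\val (exist _ x (mem_set Fx) : sft_space ne)) _ := ox.
exact: (@isolating_monochromatic R (sft_space ne) (sft_shift ne) _ _
  (occurs_once_isolating ox') _ lambda0_gt0).
Qed.
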